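(* Define, for positive integers $k,\gamma,l$, $$f(k,\gamma,l)=\begin{cases}\frac{l}{2}k\gamma+\max\{k,\gamma\} & \text{if } l \text{ is even},\\ \frac{l+1}{2}k\gamma & \text{if } l\text{ is odd}.\end{cases}$$ Then: (a) For all integers $k,l\ge2$: $\frac{(2l+1)k}{2}\le n_{dc}(k,2,l)\le \min\left\{\left\lceil\frac{(2l+1)(k+1)}{2}\right\rceil,(l+1)k\right\}$. (b) For all integers $k\ge2$, $l\ge4$, $\gamma\ge3$: $k\left\lceil\left(\frac{l-1}{2}-1\right)\gamma\right\rceil<n_{dc}(k,\gamma,l)\le f(k,\gamma,l)$. (c) For all integers $k\ge2$, $\gamma\ge3$: $k\gamma\le n_{dc}(k,\gamma,2)\le k\gamma+\max\{k,\gamma\}$. (d) For all integers $k\ge2$, $\gamma\ge3$: $k\gamma\le n_{dc}(k,\gamma,3)\le 2k\gamma$.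
   Context: A hypergraph $\mathcal{H}$ has a finite vertex set $V(\mathcal{H})$ and a family $\mathcal{E}(\mathcal{H})$ of subsets of it (hyperedges); it is $k$-uniform if all hyperedges have size $k$. A Berge path of length $l$ is a sequence $v_0,H_1,v_1,\dots,H_l,v_l$ with $v_i\in V(\mathcal{H})$ and $v_{i-1},v_i\in H_i\in\mathcal{E}(\mathcal{H})$; $\mathcal{H}$ is connected if any two vertices are joined by a Berge path. The distance $d_{\mathcal{H}}(u,v)$ is the length of a shortest Berge path from $u$ to $v$, and $B_l(u)$ is the set of vertices at distance at most $l$ from $u$. A set $D\subseteq V(\mathcal{H})$ is a distance-$l$ dominating set if $\bigcup_{u\in D}B_l(u)=V(\mathcal{H})$; $\gamma_d(\mathcal{H},l)$ is the minimum size of such a set. For $k\ge2$ and $l,\gamma\ge1$, $n_{dc}(k,\gamma,l)$ is the minimum number of vertices of a connected $k$-uniform hypergraph $\mathcal{H}$ with $\gamma_d(\mathcal{H},l)\ge\gamma$. *)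

(* Defs.v *)
From HB Require Import structures.
From mathcomp Require Import all_boot all_order all_algebra.
From mathcomp Require Import boolp classical_sets.

Set Implicit Arguments.
Unset Strict Implicit.
Unset Printing Implicit Defensive.

Import Order.TTheory GRing.Theory Num.Theory.

Record hypergraph := Hypergraph {
  vertex : finType;
  hyperedges : {set {set vertex}}
}.

Section Hypergraph.
Variable H : hypergraph.
Implicit Types (u v : vertex H) (D : {set vertex H}).

Definition uniform (k : nat) : Prop :=
  forall e : {set vertex H}, e \in hyperedges H -> #|e| = k.

(* The Berge path v_0, H_1, v_1, ..., H_l, v_l is represented by its starting
   vertex v_0 and the sequence of pairs (H_1, v_1), ..., (H_l, v_l). *)
Fixpoint berge_path u (p : seq ({set vertex H} * vertex H)) : bool :=
  if p is (e, v) :: q then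
    [&& e \in hyperedges H, u \in e, v \in e & berge_path v q]
  else true.

Definition berge_joined u v (m : nat) : bool :=
  [exists p : m.-tuple ({set vertex H} * vertex H),
     berge_path u p && (last u (unzip2 p) == v)].

Definition connected : Prop := forall u v, exists m, berge_joined u v m.

(* [is_dist u v d] means that the distance from u to v is d; no d qualifies
   when u and v are not joined by a Berge path. *)
Definition is_dist u v (d : nat) : bool :=
  berge_joined u v d && [forall m : 'I_d, ~~ berge_joined u v m].

Definition hball (l : nat) u : {set vertex H} :=
  [set v | [exists d : 'I_l.+1, is_dist u v d]].

Definition dist_dominating (l : nat) D : bool :=
  (\bigcup_(u in D) hball l u)%SET == [set: vertex H]%SET.

Lemma dist_dominatingT l : dist_dominating l [set: vertex H]%SET.
Proof.
apply/eqP/finset.setP => v; rewrite finset.in_setT; apply/finset.bigcupP; exists v => //.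
rewrite inE; apply/existsP; exists ord0; apply/andP; split.
  by apply/existsP; exists [tuple]; rewrite /= eqxx.
by apply/forallP; case.
Qed.

Definition dist_domination_number (l : nat) : nat :=
  #|[arg min_(D < [set: vertex H]%SET | dist_dominating l D) #|D| ]|.

End Hypergraph.

Definition dc_order (k gamma l n : nat) : Prop :=
  exists H : hypergraph,
    [/\ connected H, uniform H k, gamma <= dist_domination_number H l
      & #|vertex H| = n].

Definition is_n_dc (k gamma l n : nat) : Prop :=
  dc_order k gamma l n /\ forall m, dc_order k gamma l m -> n <= m.

(* The least n such that [dc_order k gamma l n], with the conventional value 0
   if there is none; by [n_dcP], any nonzero value is a genuine minimum. *)
Definition n_dc (k gamma l : nat) : nat :=
  xget 0 [set n | is_n_dc k gamma l n]%classic.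

Lemma n_dcP k gamma l : 0 < n_dc k gamma l -> is_n_dc k gamma l (n_dc k gamma l).
Proof. by rewrite /n_dc; case: xgetP => [n -> //|]. Qed.

Lemma n_dcE k gamma l n : is_n_dc k gamma l n -> n_dc k gamma l = n.
Proof.
move=> nP; rewrite /n_dc; case: xgetP => [m _ [mE mle]|/(_ n)//].
by case: nP => nE nle; apply/eqP; rewrite eqn_leq mle // nle.
Qed.

Local Open Scope ring_scope.

Definition f_bound (k gamma l : nat) : rat :=
  if odd l then (l%:R + 1) / 2 * k%:R * gamma%:R
  else l%:R / 2 * k%:R * gamma%:R + (maxn k gamma)%:R.

(* Main.v *)
Require Import Defs.
From HB Require Import structures.
From mathcomp Require Import all_boot all_order all_algebra.
From mathcomp Require Import boolp zify lra.

Set Implicit Arguments.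
Unset Strict Implicit.
Unset Printing Implicit Defensive.

Import Order.TTheory GRing.Theory Num.Theory.

(* Lower bounds for general gamma: a maximal family of disjoint hyperedges can
   be grown one hyperedge at a time so that each new member is joined to an
   earlier one by a hyperedge. This makes the family a tree with N nodes, where
   n >= k N. Tree distance s amounts to distance at most 2 s + 2 to every vertex
   near the reached node, and a tree with N > s nodes has a distance-s
   dominating set of size at most N / (s + 1). With s = l / 2 - 1 this gives
   n >= k gamma floor(l / 2), which is enough for (b), (c) and (d).

   Lower bound for gamma = 2: let A(u) be the set of vertices at distance more
   than l from u and let c minimise |A(c)|. Take a geodesic with hyperedges
   e_1, ..., e_(l+1) from c to some x in A(c), with first vertex v_1 after c.
   Minimality gives y in A(v_1) outside A(c), at distance l from c, reached by
   hyperedges f_1, ..., f_l. Unless e_1, e_2 and f_1 have a common vertex z, no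
   vertex lies in three of these 2 l + 1 hyperedges. If z exists, replace e_1 by
   two hyperedges, one far from z and one far from a vertex of e_2 and e_3: then
   only vertices of f_l can be covered three times.

   Upper bounds: take all k-subsets of suitable cliques. For f(k, gamma, l), the
   cliques are a core and the unions of consecutive layers on gamma branches;
   the ends of the branches need distinct dominating vertices. For the ceiling
   bound, 2 l + 1 blocks are arranged in a cycle, and each clique consists of a
   block and the next one with a single "gap" vertex left out: from any block,
   the gap l blocks further on is at distance l + 1. *)

(** * Distances *)

Section HypergraphMetric.
Variable H : hypergraph.
Implicit Types (u v w : vertex H) (e : {set vertex H}).

Lemma berge_joinedP u v m :
  reflect (exists p, [/\ size p = m, berge_path u p & last u (unzip2 p) = v])
          (berge_joined u v m).
Proof.
apply: (iffP existsP) => [[p /andP[pu /eqP pv]]|[p [sp pu pv]]].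
  by exists p; rewrite size_tuple.
have sp' : size p == m by rewrite sp.
by exists (Tuple sp'); rewrite pu /= pv eqxx.
Qed.

Lemma berge_joined0 u v : berge_joined u v 0 -> u = v.
Proof. by case/berge_joinedP=> p [/size0nil-> _ <-]. Qed.

Lemma berge_joined_refl u : berge_joined u u 0.
Proof. by apply/berge_joinedP; exists [::]. Qed.

Lemma berge_joinedS u v m : berge_joined u v m.+1 ->
  exists e w, [/\ e \in hyperedges H, u \in e, w \in e & berge_joined w v m].
Proof.
case/berge_joinedP=> [[|[e w] p] [//= [sp] /and4P[eE ue we wp] pv]].
by exists e, w; split=> //; apply/berge_joinedP; exists p.
Qed.

Lemma berge_joined_cons e u v w m : e \in hyperedges H -> u \in e -> w \in e ->
  berge_joined w v m -> berge_joined u v m.+1.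
Proof.
move=> eE ue we /berge_joinedP[p [sp wp pv]].
by apply/berge_joinedP; exists ((e, w) :: p); split; rewrite /= ?sp // eE ue we.
Qed.

Lemma berge_joined_trans u v w m n :
  berge_joined u v m -> berge_joined v w n -> berge_joined u w (m + n).
Proof.
elim: m u => [|m IHm] u.
  by move/berge_joined0=> ->.
case/berge_joinedS=> e [u' [eE ue u'e u'v]] vw.
by apply: (berge_joined_cons eE ue u'e); apply: IHm.
Qed.

Lemma berge_joined_edge e u v : e \in hyperedges H -> u \in e -> v \in e ->
  berge_joined u v 1.
Proof. by move=> eE ue ve; exact: (berge_joined_cons eE ue ve (berge_joined_refl v)). Qed.

Lemma berge_joined_sym u v m : berge_joined u v m -> berge_joined v u m.
Proof.
elim: m u => [|m IHm] u; first by move/berge_joined0=> ->; exact: berge_joined_refl.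
case/berge_joinedS=> e [w [eE ue we /IHm vw]].
by rewrite -addn1; apply: berge_joined_trans vw (berge_joined_edge eE we ue).
Qed.

Lemma hballP l u v :
  reflect (exists2 m, m <= l & berge_joined u v m) (v \in hball l u).
Proof.
rewrite inE; apply: (iffP existsP) => [[d /andP[uv _]]|[m ml uv]].
  by exists d; rewrite // -ltnS.
have exj : exists m, berge_joined u v m by exists m.
case: (ex_minnP exj) => d ud dmin.
have dl : d < l.+1 by rewrite ltnS (leq_trans (dmin _ uv)).
exists (Ordinal dl); rewrite /is_dist ud /=; apply/forallP=> i.
by apply/negP=> /dmin; rewrite leqNgt ltn_ord.
Qed.

Lemma hball_refl l u : u \in hball l u.
Proof. by apply/hballP; exists 0; rewrite ?berge_joined_refl. Qed.

Lemma hball_edge e u v : e \in hyperedges H -> u \in e -> v \in e -> v \in hball 1 u.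
Proof. by move=> eE ue ve; apply/hballP; exists 1 => //; exact: berge_joined_edge ve. Qed.

Lemma hball_sym l u v : v \in hball l u -> u \in hball l v.
Proof. by case/hballP=> m ml /berge_joined_sym uv; apply/hballP; exists m. Qed.

Lemma hball_trans s t r u v w : s + t <= r ->
  v \in hball s u -> w \in hball t v -> w \in hball r u.
Proof.
move=> str /hballP[m ms uv] /hballP[n nt vw]; apply/hballP.
by exists (m + n); [lia | exact: berge_joined_trans vw].
Qed.

Lemma hball_leq s t u v : s <= t -> v \in hball s u -> v \in hball t u.
Proof. by move=> st uv; apply: hball_trans uv (hball_refl 0 v); lia. Qed.

(** Indices follow the usual notation: [e i] joins [x i.-1] to [x i] for [1 <= i <= m], and [e 0]
    has no meaning. *)
Definition berge_walk (x : nat -> vertex H) (e : nat -> {set vertex H}) (m : nat) :=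
  forall i, i < m -> [/\ e i.+1 \in hyperedges H, x i \in e i.+1 & x i.+1 \in e i.+1].

Lemma berge_joined_walk u v m : berge_joined u v m ->
  exists (x : nat -> vertex H) (e : nat -> {set vertex H}),
    [/\ x 0 = u, x m = v & berge_walk x e m].
Proof.
elim: m u => [|m IHm] u.
  by move/berge_joined0=> <-; exists (fun=> u), (fun=> set0).
case/berge_joinedS=> e [w [eE ue we /IHm[x [f [x0 xm xf]]]]].
exists (fun i => if i is i'.+1 then x i' else u).
exists (fun i => if i is i'.+2 then f i'.+1 else e); split=> // -[|i] im.
  by rewrite x0.
by apply: xf.
Qed.

Lemma walk_hball (x : nat -> vertex H) (e : nat -> {set vertex H}) m :
  berge_walk x e m ->
  forall i j, i <= j -> j <= m -> x j \in hball (j - i) (x i).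
Proof.
move=> xe i j; elim: j => [|j IHj] ij jm.
  by have -> : i = 0 by [lia]; exact: hball_refl.
have [->|ij'] := eqVneq i j.+1; first exact: hball_refl.
have [eE xj xj1] := xe j jm.
apply: hball_trans (hball_edge eE xj xj1); last by apply: IHj; lia.
lia.
Qed.

Lemma walk_edge_hballl (x : nat -> vertex H) (e : nat -> {set vertex H}) m :
  berge_walk x e m ->
  forall a i w, a < i -> i <= m -> w \in e i -> w \in hball (i - a) (x a).
Proof.
move=> xe a [//|i] w ai im we.
have [eE xi xi1] := xe i im.
apply: hball_trans (walk_hball xe _ _) (hball_edge eE xi we); lia.
Qed.

Lemma walk_edge_hballr (x : nat -> vertex H) (e : nat -> {set vertex H}) m :
  berge_walk x e m ->
  forall i w, 0 < i -> i <= m -> w \in e i -> x m \in hball (m - i).+1 w.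
Proof.
move=> xe [//|i] w _ im we.
have [eE xi xi1] := xe i im.
by apply: hball_trans (hball_edge eE we xi1) (walk_hball xe _ _); lia.
Qed.

(** On a walk from [y] to [u], the last vertex before the ball is first entered is at distance
    exactly [l + 1]. *)
Lemma sphere_nonempty l u y : connected H -> y \notin hball l u ->
  exists2 x, x \notin hball l u & berge_joined u x l.+1.
Proof.
move=> cH; have [m] := cH y u; elim: m y => [|m IHm] y.
  by move/berge_joined0=> ->; rewrite hball_refl.
case/berge_joinedS=> e [w [eE ye we wu]] yNu.
have [/hballP[n nl uw]|wNu] := boolP (w \in hball l u); last exact: (IHm w).
have uy := berge_joined_trans uw (berge_joined_edge eE we ye).
exists y => //; have [<-|nl'] := eqVneq n l; first by rewrite -addn1.
by case/negP: yNu; apply/hballP; exists (n + 1) => //; lia.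
Qed.

Lemma edge_through u v : connected H -> u != v ->
  exists2 e, e \in hyperedges H & u \in e.
Proof.
move=> cH; have [[|m]] := cH u v; first by move/berge_joined0=> ->; rewrite eqxx.
by case/berge_joinedS=> e [w [eE ue _ _]] _; exists e.
Qed.

Lemma dist_dominatingP l (D : {set vertex H}) :
  reflect (forall v, exists2 u, u \in D & v \in hball l u) (dist_dominating l D).
Proof.
apply: (iffP eqP) => [DT v|DP].
  have: v \in [set: vertex H] by rewrite inE.
  by rewrite -DT => /bigcupP[u uD vu]; exists u.
by apply/setP=> v; rewrite inE; apply/bigcupP.
Qed.

Lemma dist_domination_numberP l g :
  reflect (forall D : {set vertex H}, dist_dominating l D -> g <= #|D|)
          (g <= dist_domination_number H l).
Proof.
rewrite /dist_domination_number.
case: arg_minnP => [|D DP Dmin]; first exact: dist_dominatingT.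
apply: (iffP idP) => [gD D' /Dmin|]; first exact: leq_trans.
exact.
Qed.

(** This is how distances are bounded from below in the constructions: a potential that grows by at
    most 1 inside each hyperedge grows by at most the distance. *)
Lemma hball_lipschitz (phi : vertex H -> nat) :
    (forall e x y, e \in hyperedges H -> x \in e -> y \in e -> phi y <= (phi x).+1) ->
  forall l u v, v \in hball l u -> phi v <= phi u + l.
Proof.
move=> phiE l u v /hballP[m ml]; suff: berge_joined u v m -> phi v <= phi u + m by lia.
elim: m u {ml} => [|m IHm] u; first by move/berge_joined0=> ->; rewrite addn0.
case/berge_joinedS=> e [w [eE ue we /IHm]].
have := phiE e u w eE ue we; lia.
Qed.

End HypergraphMetric.

Lemma domination_ge1_vertex (H : hypergraph) l :
  0 < dist_domination_number H l -> exists u : vertex H, true.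
Proof.
move/dist_domination_numberP => H0; have [u|V0] := pickP (vertex H); first by exists u.
have := H0 set0; rewrite cards0 => /(_ _)/negP; case; last by [].
by apply/dist_dominatingP => v; have := V0 v.
Qed.

Lemma domination_ge2_far (H : hypergraph) l (u : vertex H) :
  2 <= dist_domination_number H l -> exists y, y \notin hball l u.
Proof.
move/dist_domination_numberP => H2.
have [/existsP//|/existsPn uT] := boolP [exists y, y \notin hball l u].
have := H2 [set u]; rewrite cards1 => /(_ _)/negP; case; last by [].
apply/dist_dominatingP => v; exists u; rewrite ?set11 //.
by have := uT v; rewrite negbK.
Qed.

Lemma domination_ge2_edge (H : hypergraph) l (u : vertex H) : connected H ->
  2 <= dist_domination_number H l -> exists2 e, e \in hyperedges H & u \in e.
Proof.
move=> cH /(domination_ge2_far u)[y yu]; apply: (@edge_through _ u y cH).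
by apply: contraNneq yu => <-; exact: hball_refl.
Qed.

(** * Hypergraphs of large radius *)

Lemma sum_card_multiplicity (T I : finType) (F : I -> {set T}) :
  \sum_i #|F i| = \sum_x #|[set i | x \in F i]|.
Proof.
under eq_bigr do rewrite -sum1_card big_mkcond.
rewrite exchange_big; apply: eq_bigr => x _.
by rewrite -sum1_card [RHS]big_mkcond; apply: eq_bigr => i _; rewrite inE.
Qed.

Lemma card_multiplicity_le2 n (P : pred 'I_n) :
  (forall a b c : 'I_n, a < b -> b < c -> P a -> P b -> P c -> False) ->
  #|[set i | P i]| <= 2.
Proof.
move=> P3; rewrite leqNgt; apply/negP => /card_gt2P[a [b [c [[]]]]].
rewrite !inE => Pa Pb Pc [ab bc ca].
have nn (i j : 'I_n) : i != j -> (i < j) || (j < i) by rewrite -neq_ltn.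
by move: (nn _ _ ab) (nn _ _ bc) (nn _ _ ca) => /orP[] h1 /orP[] h2 /orP[] h3;
  first [lia | exact: (P3 a b c) | exact: (P3 b c a) | exact: (P3 c a b)
        | exact: (P3 a c b) | exact: (P3 b a c) | exact: (P3 c b a)].
Qed.

(* [lia] on the purely arithmetic part of the context: membership hypotheses
   are booleans, on which [lia] would split. *)
Ltac arith :=
  repeat match goal with
  | h : is_true (_ \in _) |- _ => clear h
  | h : is_true (_ \notin _) |- _ => clear h
  end; lia.

(** * Multiplicities along two geodesic branches *)

Section TwoBranches.
Variables (T : finType) (e f : nat -> {set T}) (l : nat).
Hypothesis EE : forall i j t, 0 < i -> i < j -> j <= l.+1 ->
  t \in e i -> t \in e j -> j = i.+1.
Hypothesis FF : forall i j t, 0 < i -> i < j -> j <= l ->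
  t \in f i -> t \in f j -> j = i.+1.
Hypothesis EF : forall i j t, 1 < i -> i <= l.+1 -> 0 < j -> j <= l ->
  t \in e i -> t \in f j -> i = j.+1.
Hypothesis EF1 : forall j t, 0 < j -> j <= l -> t \in e 1 -> t \in f j -> j = 1.

(** The hyperedges are listed from one far end to the other: e_(l+1), ..., e_1, f_1, ..., f_l. *)
Definition long_branches (a : 'I_(2 * l + 1)) :=
  if a <= l then e (l.+1 - a) else f (a - l).

(** The same list without e_1, for the case in which e_1 is replaced. *)
Definition short_branches (a : 'I_(2 * l)) :=
  if a < l then e (l.+1 - a) else f (a - l).+1.

(** Three hyperedges of one branch cannot be pairwise consecutive, and [EF] leaves each hyperedge of
    one branch a single possible partner on the other. *)
Lemma short_branches_multiplicity t : #|[set a | t \in short_branches a]| <= 2.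
Proof.
apply: card_multiplicity_le2 => a b d ab bd; rewrite /short_branches.
have dl := ltn_ord d.
have [al|al] := ltnP a l; have [bl|bl] := ltnP b l;
  have [dl'|dl'] := ltnP d l => ta tb td; try arith.
- have : l.+1 - a = (l.+1 - d).+1 by apply: EE td ta; arith.
  by arith.
- have : l.+1 - a = (d - l).+2 by apply: EF ta td; arith.
  have : l.+1 - b = (d - l).+2 by apply: EF tb td; arith.
  by arith.
- have : l.+1 - a = (d - l).+2 by apply: EF ta td; arith.
  have : l.+1 - a = (b - l).+2 by apply: EF ta tb; arith.
  by arith.
- have : (d - l).+1 = (a - l).+2 by apply: FF ta td; arith.
  by arith.
Qed.

(** Only e_1 escapes the matching [EF]. A triple must therefore contain it, and [EF1] and [EF] then
    force the triple e_1, e_2, f_1. *)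
Lemma long_branches_multiplicity t :
  ~~ [&& t \in e 1, t \in e 2 & t \in f 1] ->
  #|[set a | t \in long_branches a]| <= 2.
Proof.
move=> noz; apply: card_multiplicity_le2 => a b d ab bd; rewrite /long_branches.
have dl := ltn_ord d.
have [al|al] := leqP a l; have [bl|bl] := leqP b l;
  have [dl'|dl'] := leqP d l => ta tb td; try arith.
- have : l.+1 - a = (l.+1 - d).+1 by apply: EE td ta; arith.
  by arith.
- have da : l.+1 - a = (d - l).+1 by apply: EF ta td; arith.
  have [b1|b1] := eqVneq (b : nat) l; last first.
    have : l.+1 - b = (d - l).+1 by apply: EF tb td; arith.
    by arith.
  rewrite b1 subSnn in tb.
  have d1 : d - l = 1 by apply: EF1 tb td; arith.
  by rewrite da d1 in ta; rewrite d1 in td; rewrite tb ta td in noz.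
- have [a1|a1] := eqVneq (a : nat) l.
    rewrite a1 subSnn in ta.
    have : d - l = 1 by apply: EF1 ta td; arith.
    by arith.
  have : l.+1 - a = (d - l).+1 by apply: EF ta td; arith.
  have : l.+1 - a = (b - l).+1 by apply: EF ta tb; arith.
  by arith.
- have : d - l = (a - l).+1 by apply: FF ta td; arith.
  by arith.
Qed.

End TwoBranches.

(** * The order of hypergraphs in which no ball of radius l is everything *)

Section RadiusBound.
Variables (H : hypergraph) (k l : nat).
Hypotheses (l_ge2 : 2 <= l) (cH : connected H) (uH : uniform H k).
Hypothesis far : forall u : vertex H, exists y, y \notin hball l u.

(** Any hyperedge through a vertex at distance more than [l] from [u] stays at distance at least
    [l]. *)
Lemma far_edge (u : vertex H) : exists2 h, h \in hyperedges H &
  forall w, w \in h -> w \notin hball l.-1 u.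
Proof.
have [y yu] := far u.
have yNu : y != u by apply: contraNneq yu => ->; exact: hball_refl.
have [h hE yh] := edge_through cH yNu.
exists h => // w wh; apply: contra yu => uw.
by apply: hball_trans uw (hball_edge hE wh yh); arith.
Qed.

Lemma radius_order_bound (u0 : vertex H) : (2 * l + 1) * k <= 2 * #|vertex H|.
Proof.
have cT : #|(xpredT : pred (vertex H))| = #|vertex H| by apply: eq_card.
pose A (u : vertex H) := ~: hball l u.
have [c cmin] : exists c, forall v, #|A c| <= #|A v|.
  exists [arg min_(u < u0) #|A u|] => v.
  by case: arg_minnP => // u _; apply.
have [x0 x0c] := far c.
have [x xc] := sphere_nonempty cH x0c.
case/berge_joined_walk => v [e [v0 vx ve]].
have v1x : x \in hball l (v 1).
  by have := walk_hball ve (isT : 1 <= l.+1) (leqnn _); rewrite subn1 vx.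
(* An inclusion of [A (v 1)] in [A c] would be proper, because [x] lies in [A c] only; this
   contradicts the choice of [c]. *)
have [y yv1 yc] : exists2 y, y \notin hball l (v 1) & y \in hball l c.
  have /subsetPn[y] : ~~ (A (v 1) \subset A c).
    apply/negP => sA; have /proper_card : A (v 1) \proper A c.
      by apply/properP; split=> //; exists x; rewrite in_setC ?negbK.
    by rewrite ltnNge cmin.
  by rewrite !in_setC negbK => yv1 yc; exists y.
have [e1E v0e1 v1e1] := ve 0 isT; rewrite v0 in v0e1.
have yc' : y \notin hball l.-1 c.
  apply: contra yv1 => yc'; apply: hball_trans (hball_edge e1E v1e1 v0e1) yc'; arith.
have [m ml cy] := hballP _ _ _ yc.
have {ml} ml : m = l.
  apply/eqP; rewrite eqn_leq ml leqNgt; apply/negP => ml'.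
  by case/negP: yc'; apply/hballP; exists m => //; arith.
case/berge_joined_walk: cy; rewrite {}ml => w [f [w0 wy wf]].
(* If j >= i + 2, the shortcut through [t] would bring [x] within i + (l + 2 - j) <= l of [c]. *)
have EE i j t : 0 < i -> i < j -> j <= l.+1 -> t \in e i -> t \in e j -> j = i.+1.
  move=> i0 ij jl ti tj.
  apply/eqP; rewrite eqn_leq ij andbT leqNgt; apply/negP => ij2.
  case/negP: xc; rewrite -vx.
  have ct := walk_edge_hballl ve i0 (leq_trans (ltnW ij) jl) ti.
  have tx := walk_edge_hballr ve (leq_trans i0 (ltnW ij)) jl tj.
  by rewrite v0 in ct; apply: hball_trans ct tx; arith.
have FF i j t : 0 < i -> i < j -> j <= l -> t \in f i -> t \in f j -> j = i.+1.
  move=> i0 ij jl ti tj.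
  apply/eqP; rewrite eqn_leq ij andbT leqNgt; apply/negP => ij2.
  case/negP: yc'; rewrite -wy.
  have ct := walk_edge_hballl wf i0 (leq_trans (ltnW ij) jl) ti.
  have tx := walk_edge_hballr wf (leq_trans i0 (ltnW ij)) jl tj.
  by rewrite w0 in ct; apply: hball_trans ct tx; arith.
(* If i <= j, the route through [t] leads from v_1 to [y] in (i - 1) + (l - j + 1) <= l steps; if i
   >= j + 2, it leads from [c] to [x] in j + (l + 2 - i) <= l steps. *)
have EF i j t : 1 < i -> i <= l.+1 -> 0 < j -> j <= l -> t \in e i -> t \in f j -> i = j.+1.
  move=> i1 il j0 jl ti tj.
  have [ij|ij|//] := ltngtP i j.+1.
    case/negP: yv1; rewrite -wy.
    have vt := walk_edge_hballl ve i1 il ti.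
    have ty := walk_edge_hballr wf j0 jl tj.
    by apply: hball_trans vt ty; arith.
  case/negP: xc; rewrite -vx.
  have ct := walk_edge_hballl wf j0 jl tj; rewrite w0 in ct.
  have tx := walk_edge_hballr ve (ltnW i1) il ti.
  by apply: hball_trans ct tx; arith.
have EF1 j t : 0 < j -> j <= l -> t \in e 1 -> t \in f j -> j = 1.
  move=> j0 jl te tj; apply/eqP; rewrite eqn_leq j0 andbT leqNgt; apply/negP => j1.
  case/negP: yv1; rewrite -wy.
  have vt := hball_edge e1E v1e1 te.
  have ty := walk_edge_hballr wf j0 jl tj.
  by apply: hball_trans vt ty; arith.
have eE i : 0 < i -> i <= l.+1 -> #|e i| = k.
  by case: i => // i _ il; apply: uH; case: (ve i il).
have fE i : 0 < i -> i <= l -> #|f i| = k.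
  by case: i => // i _ il; apply: uH; case: (wf i il).
have [/existsP[z /and3P[ze1 ze2 zf1]]|/existsPn noz] :=
  boolP [exists z, [&& z \in e 1, z \in e 2 & z \in f 1]].
- pose F := short_branches e f (l := l).
  have Fk a : #|F a| = k.
    rewrite /F /short_branches; have := ltn_ord a; case: ifP => al ak.
      by apply: eE; arith.
    by apply: fE; arith.
  have F2 t : #|[set a | t \in F a]| <= 2 by exact: short_branches_multiplicity.
  have [h hE hz] := far_edge z.
  have [h' h'E h'v] := far_edge (v 2).
  have [e2E v1e2 v2e2] := ve 1 (ltnW l_ge2).
  have [f1E w0f1 w1f1] := wf 0 (ltnW l_ge2).
  have zball_e i t : 1 < i -> i <= l.+1 -> t \in e i -> t \in hball i.-1 z.
    move=> i1 il ti; have [i2|i2] := eqVneq i 2.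
      by rewrite i2 in ti *; exact: hball_edge ze2 ti.
    have vt : t \in hball (i - 2) (v 2) by apply: (walk_edge_hballl ve) ti; arith.
    by apply: hball_trans (hball_edge e2E ze2 v2e2) vt; arith.
  have zball_f j t : 0 < j -> j <= l -> t \in f j -> t \in hball j z.
    move=> j0 jl tj; have [j1|j1] := eqVneq j 1.
      by rewrite j1 in tj *; exact: hball_edge zf1 tj.
    have wt : t \in hball (j - 1) (w 1) by apply: (walk_edge_hballl wf) tj; arith.
    by apply: hball_trans (hball_edge f1E zf1 w1f1) wt; arith.
  have vball_e i t : 1 < i -> i <= l.+1 -> t \in e i -> t \in hball l.-1 (v 2).
    move=> i1 il ti; have [i2|i2] := eqVneq i 2.
      by rewrite i2 in ti; apply: hball_leq (hball_edge e2E v2e2 ti); arith.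
    have vt : t \in hball (i - 2) (v 2) by apply: (walk_edge_hballl ve) ti; arith.
    by apply: hball_leq vt; arith.
  have vball_f j t : 0 < j -> j.+2 <= l -> t \in f j -> t \in hball l.-1 (v 2).
    move=> j0 jl tj.
    have zt : t \in hball j z by apply: zball_f => //; arith.
    by apply: hball_trans (hball_edge e2E v2e2 ze2) zt; arith.
  (* All hyperedges of [F] except e_(l+1) (index 0) and f_l (index 2l - 1) lie within l - 1 of [z],
     so [h] avoids them. *)
  have hF t (a : 'I_(2 * l)) : t \in h -> t \in F a ->
      a = 0 :> nat \/ a = (2 * l).-1 :> nat /\ t \in f l.
    move=> th; have := hz t th; have := ltn_ord a; rewrite /F /short_branches => al tz.
    case: ifP => al' ta.
      left; apply/eqP/negPn/negP => a0; case/negP: tz.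
      by apply: hball_leq (zball_e _ _ _ _ ta); arith.
    have [aE|aE] := eqVneq (a - l).+1 l; first by right; rewrite aE in ta; split=> //; arith.
    by case/negP: tz; apply: hball_leq (zball_f _ _ _ _ ta); arith.
  (* Every e_i with i > 1 lies within l - 1 of v_2, and so does f_j for j <= l - 2, by a detour
     through [z]. Only f_(l-1) (index 2l - 2) and f_l remain. *)
  have h'F t (a : 'I_(2 * l)) : t \in h' -> t \in F a ->
      a = (2 * l).-2 :> nat \/ a = (2 * l).-1 :> nat /\ t \in f l.
    move=> th; have := h'v t th; have := ltn_ord a; rewrite /F /short_branches => al tz.
    case: ifP => al' ta.
      by case/negP: tz; apply: vball_e ta; arith.
    have [aE|aE] := eqVneq (a - l).+1 l; first by right; rewrite aE in ta; split=> //; arith.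
    left; apply/eqP/negPn/negP => a0.
    by case/negP: tz; apply: vball_f ta; arith.
  (* Off f_l, [h] allows only index 0 and [h'] only index 2l - 2, which differ since l >= 2. Summing
     over [t] gives 2lk + 2k <= 2n + k. *)
  have mult t : #|[set a | t \in F a]| + (t \in h) + (t \in h') <= 2 + (t \in f l).
    have le1 c0 : (forall a : 'I_(2 * l), t \in F a -> a = c0 :> nat) ->
        #|[set a | t \in F a]| <= 1.
      move=> Fc; apply/card_le1_eqP => a b; rewrite !inE => /Fc ac /Fc bc.
      by apply: val_inj; rewrite /= ac bc.
    have := F2 t; move: (hF t) (h'F t).
    case: (t \in h); case: (t \in h'); case: (t \in f l) => hF' h'F' F2t; try arith.
    - rewrite (leq_add (leq_add (le1 (2 * l).-1 _) (leqnn _)) (leqnn _)) // => a ta.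
      by case: (hF' a isT ta) => [|[]]; case: (h'F' a isT ta) => [|[]]; arith.
    - suff -> : [set a | t \in F a] = set0 by rewrite cards0.
      apply/setP => a; rewrite !inE; apply/negP => ta.
      by case: (hF' a isT ta) => [|[]] //; case: (h'F' a isT ta) => [|[]] //; arith.
    - rewrite (leq_add (leq_add (le1 0 _) (leqnn _)) (leqnn _)) // => a ta.
      by case: (hF' a isT ta) => [|[]].
    - rewrite (leq_add (leq_add (le1 (2 * l).-2 _) (leqnn _)) (leqnn _)) // => a ta.
      by case: (h'F' a isT ta) => [|[]].
  have sumb (B : {set vertex H}) : \sum_t (t \in B : nat) = #|B|.
    by rewrite -sum1_card [RHS]big_mkcond; apply: eq_bigr => t _; case: (t \in B).
  have /= := @leq_sum _ (index_enum (vertex H)) xpredT _ _ (fun t _ => mult t).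
  rewrite !big_split /= !sumb -sum_card_multiplicity (eq_bigr (fun=> k)) //.
  rewrite !sum_nat_const card_ord (uH hE) (uH h'E) (fE l) ?cT //; arith.
pose F := long_branches e f (l := l).
have Fk a : #|F a| = k.
  rewrite /F /long_branches; have := ltn_ord a; case: ifP => al ak.
    by apply: eE; arith.
  by apply: fE; arith.
have F2 t : #|[set a | t \in F a]| <= 2 by exact: long_branches_multiplicity (noz t).
have /= := @leq_sum _ (index_enum (vertex H)) xpredT _ _ (fun t _ => F2 t).
by rewrite -sum_card_multiplicity (eq_bigr (fun=> k)) // !sum_nat_const card_ord ?cT; arith.
Qed.
End RadiusBound.

(** * Domination in trees *)

Definition induced (T : finType) (C : {set T}) (e : rel T) : rel T :=
  [rel x y | [&& x \in C, y \in C & e x y]].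

Lemma induced_sym (T : finType) (C : {set T}) (e : rel T) :
  symmetric e -> symmetric (induced C e).
Proof. by move=> se x y; rewrite /induced /= se andbCA. Qed.

Lemma connect_induced_sub (T : finType) (C C' : {set T}) (e : rel T) x y :
  C \subset C' -> connect (induced C e) x y -> connect (induced C' e) x y.
Proof.
move=> /subsetP sC; apply: connect_sub => a b /and3P[aC bC ab].
by apply: connect1; rewrite /induced /= !sC.
Qed.

(** A path without repetition has fewer steps than [C] has points; this turns sizes of subtrees into
    distances. *)
Lemma connect_induced_path (T : finType) (C : {set T}) (e : rel T) x y :
  x \in C -> connect (induced C e) x y ->
  exists q, [/\ path e x q, last x q = y & size q < #|C|].
Proof.
move=> xC /connectP[q xq ->]; case: (shortenP xq) => {xq}q' xq' uq' _.
exists q'; split=> //; first by apply: sub_path xq' => a b /and3P[].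
have sq : {subset x :: q' <= C}.
  elim: q' x xC xq' {uq'} => [|z q' IHq] x xC /=; first by move=> _ a; rewrite inE => /eqP->.
  by case/andP=> /and3P[_ zC _] /(IHq z zC) sq a; rewrite inE => /orP[/eqP->|/sq].
by have := uniq_leq_size uq' (s2 := enum C); rewrite -cardE; apply=> a /sq; rewrite mem_enum.
Qed.

Section RootedTree.
Variables (N : nat) (p : 'I_N.+1 -> 'I_N.+1).
Hypotheses (p0 : p ord0 = ord0) (p_lt : forall i, i != ord0 -> p i < i).
Implicit Types (i a b w : 'I_N.+1) (S : {set 'I_N.+1}).

(** The tree is given by its parent map: parents have smaller indices and the root is its own
    parent, which puts a loop at [ord0]. *)
Definition tree_edge : rel 'I_N.+1 := [rel x y | (p x == y) || (p y == x)].

Definition parent_closed S := forall i, i \in S -> p i \in S.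

Definition subtree S a := [set w in S | fconnect p w a].

Lemma tree_edge_sym : symmetric tree_edge.
Proof. by move=> x y; rewrite /tree_edge /= orbC. Qed.

Lemma parent_le i : p i <= i.
Proof. by have [->|/p_lt/ltnW//] := eqVneq i ord0; rewrite p0. Qed.

Lemma fconnect_le w a : fconnect p w a -> a <= w.
Proof.
move=> /iter_findex <-; elim: (findex p w a) => //= n IHn.
exact: leq_trans (parent_le _) IHn.
Qed.

Lemma fconnect_root w : fconnect p w ord0.
Proof.
move: {2}(w : nat) (leqnn w) => n; elim: n w => [|n IHn] w wn.
  by have -> : w = ord0 by apply: val_inj => /=; lia.
have [->//|w0] := eqVneq w ord0.
by apply: connect_trans (fconnect1 p w) (IHn _ _); have := p_lt w0; lia.
Qed.

Lemma fconnect_last_step w a : fconnect p w a ->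
  w = a \/ exists b, [/\ p b = a, b != a & fconnect p w b].
Proof.
move=> /iter_findex; move: (findex p w a) => n.
elim: n => [|n IHn] /=; first by left.
have [/IHn//|ba pb] := eqVneq (iter n p w) a.
by right; exists (iter n p w); split=> //; exact: fconnect_iter.
Qed.

Lemma connect_subtree S w b : parent_closed S -> w \in subtree S b ->
  connect (induced (subtree S b) tree_edge) w b.
Proof.
move=> Sp; rewrite inE => /andP[wS /iter_findex]; move: (findex p w b) => n.
elim: n w wS => [|n IHn] w wS; first by move=> /= ->.
rewrite iterSr => nb; apply: connect_trans (connect1 _) (IHn _ (Sp _ wS) nb).
rewrite /induced /= !inE wS Sp // /tree_edge /= eqxx andbT.
have pwb : fconnect p (p w) b by rewrite -nb fconnect_iter.
by rewrite pwb (connect_trans (fconnect1 p w) pwb).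
Qed.

Lemma subtree_root S : subtree S ord0 = S.
Proof. by apply/setP=> w; rewrite inE fconnect_root andbT. Qed.

(* Cut off minimal subtrees with more than [s] nodes: the root of such a
   subtree is within distance [s] of all of it, and of the rest of the tree
   once that rest has at most [s] nodes. *)
Lemma tree_domination_closed s S : parent_closed S -> s < #|S| ->
  exists2 D : {set 'I_N.+1}, #|D| * s.+1 <= #|S| &
    forall i, i \in S -> exists2 d, d \in D &
      exists q, [/\ path tree_edge d q, last d q = i & size q <= s].
Proof.
have [n] := ubnP #|S|; elim: n S => // n IHn S Sn Sp Ss.
have [j0 j0S] : exists j0, j0 \in S by apply/card_gt0P; lia.
have S0 : ord0 \in S.
  have /iter_findex <- := fconnect_root j0.
  by elim: (findex _ _ _) => //= m; apply: Sp.
pose big a := (a \in S) && (s < #|subtree S a|).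
have big0 : big ord0 by rewrite /big S0 subtree_root.
(* The largest index is taken because children have larger indices than their parent: no child of
   [a] is [big]. *)
case: (arg_maxnP (fun a => val a) big0) => a /andP[aS sa] amax.
have adom i : i \in subtree S a ->
    exists q, [/\ path tree_edge a q, last a q = i & size q <= s].
  rewrite inE => /andP[iS /fconnect_last_step[->|[b [pb ba ib]]]].
    by exists [::].
  have b0 : b != ord0.
    by apply: contraNneq ba => b0; rewrite -pb b0 p0.
  have bS : b \in S.
    by have /iter_findex <- := ib; elim: (findex _ _ _) => //= m; apply: Sp.
  have bs : #|subtree S b| <= s.
    rewrite leqNgt; apply/negP => bs.
    by have /= := amax b; rewrite /big bS bs => /(_ isT); have := p_lt b0; rewrite pb; lia.
  have bb : b \in subtree S b by rewrite inE bS connect0.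
  have bi : connect (induced (subtree S b) tree_edge) b i.
    rewrite (sym_connect_sym (induced_sym _ tree_edge_sym)).
    by apply: connect_subtree; rewrite ?inE ?iS.
  have [q [bq qi qs]] := connect_induced_path bb bi.
  exists (b :: q); split=> //=; first by rewrite bq andbT /tree_edge /= pb eqxx orbT.
  exact: leq_trans qs bs.
pose R := S :\: subtree S a.
have cardS : #|S| = #|subtree S a| + #|R|.
  rewrite -(cardsID (subtree S a) S) (setIidPr _) //.
  by apply/subsetP => i; rewrite inE => /andP[].
have Rp : parent_closed R.
  move=> i; rewrite !inE => /andP[+ iS]; rewrite iS /= (Sp _ iS) andbT /=.
  by apply: contra => pia; apply: connect_trans (fconnect1 p i) pia.
(* A simple path from [a] via its parent inside [a |: R] visits at most s + 1 nodes, hence makes at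
   most s steps. *)
have [Rs|Rs] := leqP #|R| s.
  exists [set a]; first by rewrite cards1 mul1n; lia.
  move=> i iS; exists a; rewrite ?inE //.
  have [/adom//|iNa] := boolP (i \in subtree S a).
  have iR : i \in R by rewrite inE iNa.
  have a0 : a != ord0.
    by apply: contraNneq iNa => ->; rewrite subtree_root.
  have paR : p a \in R.
    rewrite !inE (Sp _ aS) andbT /=; apply/negP => /fconnect_le.
    by have := p_lt a0; lia.
  have toroot j : j \in R -> connect (induced (a |: R) tree_edge) j ord0.
    move=> jR; apply: (@connect_induced_sub _ R); first exact: subsetUr.
    have := @connect_subtree R j ord0 Rp; rewrite subtree_root; exact.
  have ai : connect (induced (a |: R) tree_edge) a i.
    apply: connect_trans (connect1 _) (connect_trans (toroot _ paR) _).
      by rewrite /induced /= !in_setU1 eqxx paR orbT /tree_edge /= eqxx.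
    by rewrite (sym_connect_sym (induced_sym _ tree_edge_sym)) toroot.
  have [|q [aq qi qs]] := connect_induced_path _ ai; first by rewrite !inE eqxx.
  exists q; split=> //.
  by rewrite -ltnS (leq_trans qs) // cardsU1 -[s.+1]add1n leq_add ?leq_b1.
have [|D Ds Ddom] := IHn R _ Rp Rs; first by lia.
exists (a |: D).
  have aD : #|a |: D| <= #|D|.+1 by rewrite cardsU1 -[#|D|.+1]add1n leq_add ?leq_b1.
  by rewrite (leq_trans (leq_mul aD (leqnn _))) // mulSn cardS leq_add.
move=> i iS; have [/adom ai|iNa] := boolP (i \in subtree S a).
  by exists a; rewrite ?inE ?eqxx.
have [|d dD dq] := Ddom i; first by rewrite inE iNa.
by exists d; rewrite // inE dD orbT.
Qed.

(** The alternative [#|D| <= 1] serves trees with at most [s] nodes, where the root alone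
    suffices. *)
Lemma tree_domination s :
  exists2 D : {set 'I_N.+1}, #|D| <= 1 \/ #|D| * s.+1 <= N.+1 &
    forall i, exists2 d, d \in D &
      exists q, [/\ path tree_edge d q, last d q = i & size q <= s].
Proof.
have Tp : parent_closed setT by move=> i _; rewrite inE.
have [Ns|sN] := leqP N.+1 s; last first.
  have := @tree_domination_closed s setT Tp; rewrite cardsT card_ord => /(_ sN).
  case=> D Ds Ddom; exists D; first by right.
  by move=> i; apply: Ddom; rewrite inE.
exists [set ord0]; first by left; rewrite cards1.
move=> i; exists ord0; rewrite ?inE //.
have := @connect_subtree setT i ord0 Tp.
rewrite subtree_root inE => /(_ isT).
rewrite (sym_connect_sym (induced_sym _ tree_edge_sym)).
case/(connect_induced_path (in_setT _)) => q [q0 qi].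
by rewrite cardsT card_ord => qs; exists q; split=> //; exact: leq_trans (ltnW qs) Ns.
Qed.

End RootedTree.

(** * Packing disjoint hyperedges *)

Section Packing.
Variables (H : hypergraph) (k : nat).
Hypotheses (k_gt0 : 0 < k) (cH : connected H) (uH : uniform H k).
Implicit Types (g h : {set vertex H}) (u v w : vertex H) (m : nat -> {set vertex H}).

Definition linked g h :=
  exists d a b, [/\ d \in hyperedges H, a \in g, a \in d, b \in d & b \in h].

Lemma linked_sym g h : linked g h -> linked h g.
Proof. by case=> d [a [b [? ? ? ? ?]]]; exists d, b, a. Qed.

Definition tree_packing N m (p : nat -> nat) :=
  [/\ forall i, i <= N -> m i \in hyperedges H,
      forall i j, i < j -> j <= N -> [disjoint m i & m j]
    & forall i, 0 < i -> i <= N -> p i < i /\ linked (m i) (m (p i))].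

Definition saturated N m :=
  forall g, g \in hyperedges H -> exists i x, [/\ i <= N, x \in g & x \in m i].

Lemma tree_packing_card N m p : tree_packing N m p -> N.+1 * k <= #|vertex H|.
Proof.
move=> [mE mD _].
have <- : \sum_(i < N.+1) #|m i| = N.+1 * k.
  rewrite (eq_bigr (fun=> k)) ?sum_nat_const ?card_ord // => i _.
  by apply: uH; apply: mE; rewrite -ltnS.
rewrite sum_card_multiplicity -sum1_card; apply: leq_sum => x _.
apply/card_le1_eqP => i j; rewrite !inE => xi xj; apply: val_inj => /=.
have disj (i' j' : 'I_N.+1) : i' < j' -> x \in m i' -> x \in m j' -> False.
  move=> ij xi' xj'; have jN : j' <= N by rewrite -ltnS.
  by have /pred0P/(_ x) := mD _ _ ij jN; rewrite /= xi' xj'.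
by case: (ltngtP i j) => // ij; [case: (disj _ _ ij xi xj) | case: (disj _ _ ij xj xi)].
Qed.

Lemma hyperedge_neq0 g : g \in hyperedges H -> exists x, x \in g.
Proof. by move=> gE; apply/card_gt0P; rewrite (uH gE). Qed.

(** Along the walk, the first hyperedge disjoint from [U] shares a vertex with its predecessor,
    which still meets [U]. *)
Lemma adjacent_free_edge (U : {set vertex H}) u v n g h :
    berge_joined u v n -> h \in hyperedges H -> v \in h -> [disjoint h & U] ->
    g \in hyperedges H -> u \in g -> ~~ [disjoint g & U] ->
  exists h', [/\ h' \in hyperedges H, [disjoint h' & U]
    & exists g' a, [/\ g' \in hyperedges H, ~~ [disjoint g' & U], a \in h' & a \in g']].
Proof.
move=> + hE vh hU; elim: n u g => [|n IHn] u g.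
  by move/berge_joined0=> -> gE vg gU; exists h; split=> //; exists g, v.
case/berge_joinedS=> e [w [eE ue we wv]] gE ug gU.
have [eU|eU] := boolP [disjoint e & U]; first by exists e; split=> //; exists g, u.
exact: (IHn w e).
Qed.

Lemma tree_packing_extend N m p : tree_packing N m p -> ~ saturated N m ->
  exists m' p', tree_packing N.+1 m' p'.
Proof.
move=> [mE mD mp] /existsNP[h /not_implyP[hE hm]].
pose U := \bigcup_(i < N.+1) m i.
have UP x : reflect (exists2 i, i <= N & x \in m i) (x \in U).
  apply: (iffP bigcupP) => [[i _ xi]|[i iN xi]]; first by exists i => //; exact: (ltn_ord i).
  by exists (Ordinal (iN : i < N.+1)).
have hU : [disjoint h & U].
  apply/pred0P => x /=; apply/negP => /andP[xh /UP[i iN xi]].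
  by apply: hm; exists i, x.
have [u um] := hyperedge_neq0 (mE 0 isT).
have [v vh] := hyperedge_neq0 hE.
have [n uv] := cH u v.
have m0U : ~~ [disjoint m 0 & U].
  by apply/pred0Pn; exists u; rewrite /= um; apply/UP; exists 0.
have [h' [h'E h'U [g [a [gE gU ah' ag]]]]] := adjacent_free_edge uv hE vh hU (mE 0 isT) um m0U.
have /pred0Pn[b /= /andP[bg /UP[j jN bj]]] := gU.
exists (fun i => if i <= N then m i else h'), (fun i => if i <= N then p i else j).
split=> [i iN|i i' ii' i'N|i i0 iN].
- by case: ifP => // /mE.
- have iN : i <= N by rewrite -ltnS (leq_trans ii').
  rewrite iN.
  case: ifP => i'N'; first exact: mD.
  rewrite disjoint_sym; apply/pred0P => x /=; apply/negP => /andP[xh' xi].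
  by have /pred0P/(_ x) := h'U; rewrite /= xh' => /negP; apply; apply/UP; exists i.
- have [iN'|iN'] := leqP i N.
    have [pi pl] := mp i i0 iN'; rewrite pi.
    by rewrite (leq_trans (ltnW pi) iN').
  by rewrite jN (leq_ltn_trans jN iN'); split=> //; exists g, a, b.
Qed.

(** A packing that could always be extended would eventually need more vertices than there are. *)
Lemma saturated_tree_packing g : g \in hyperedges H ->
  exists N m p, tree_packing N m p /\ saturated N m.
Proof.
move=> gE; apply: contrapT => noN.
have allN N : exists m p, tree_packing N m p.
  elim: N => [|N [m [p mp]]].
    by exists (fun=> g), id; split=> // [i [|//] //|[|i] //].
  by apply: (tree_packing_extend mp) => mS; apply: noN; exists N, m, p.
have [m [p /tree_packing_card]] := allN #|vertex H|.
by rewrite leqNgt mulnC; have := leq_pmull #|vertex H|.+1 k_gt0; lia.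
Qed.

Lemma tree_packing_bound gamma l : 2 <= l -> 2 <= gamma ->
  gamma <= dist_domination_number H l -> k * gamma * l./2 <= #|vertex H|.
Proof.
move=> l2 g2 gH; have gH2 := leq_trans g2 gH.
have gD := dist_domination_numberP _ _ _ gH.
have [u _] := domination_ge1_vertex (ltnW gH2).
have [g0 g0E _] := domination_ge2_edge u cH gH2.
have [N [m [p [mp mS]]]] := saturated_tree_packing g0E.
have NV := tree_packing_card mp; case: mp => mE mD mp.
pose q (i : 'I_N.+1) : 'I_N.+1 := if i == ord0 then ord0 else inord (p i).
have q0 : q ord0 = ord0 by rewrite /q eqxx.
have qE i : i != ord0 -> q i = p i :> nat /\ p i < i.
  move=> i0; have i_gt0 : 0 < i by rewrite lt0n.
  have [pi _] := mp i i_gt0 (ltn_ord i : i <= N).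
  by rewrite /q (negbTE i0) inordK // (leq_trans pi (ltnW (ltn_ord i))).
have q_lt i : i != ord0 -> q i < i by case/qE=> ->.
have linkE i j : tree_edge q i j -> linked (m i) (m j).
  suff parent (a b : 'I_N.+1) : q a = b -> linked (m a) (m b).
    by case/orP=> /eqP/parent // /linked_sym.
  move=> <-; have [->|a0] := eqVneq a ord0.
    rewrite q0; have [x xm] := hyperedge_neq0 (mE 0 isT).
    by exists (m 0), x, x; split=> //; exact: mE.
  have [-> _] := qE a a0; apply: (mp _ _ _).2; last by rewrite -ltnS.
  by rewrite lt0n; apply: contraNneq a0 => a0; apply/eqP/val_inj.
(* Each tree step costs two hyperedges, a member and a linking one; the last member adds one
   more. *)
have path_ball i r x y : path (tree_edge q) i r -> x \in m i -> y \in m (last i r) ->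
    y \in hball (size r).*2.+1 x.
  elim: r i x => [|j r IHr] i x /=.
    by move=> _ xi yi; apply: hball_edge xi yi; apply: mE; rewrite -ltnS.
  case/andP=> /linkE[d [a [b [dE ai ad bd bj]]]] jr xi yl.
  have xa : a \in hball 1 x by apply: hball_edge xi ai; apply: mE; rewrite -ltnS.
  have xb := hball_trans (leqnn _) xa (hball_edge dE ad bd).
  by apply: hball_trans xb (IHr _ _ jr bj yl); lia.
(* Radius s = l/2 - 1 (with l/2 rounded down) is chosen so that 2s + 1, plus one hyperedge meeting
   the packing, is at most l. *)
have [D Ds Ddom] := tree_domination q0 q_lt (l./2).-1.
have /choice[r rP] : forall i : 'I_N.+1, exists x, x \in m i.
  by move=> i; apply: hyperedge_neq0; apply: mE; rewrite -ltnS.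
have : gamma <= #|r @: D|.
  apply/gD/dist_dominatingP => v.
  have [g gE vg] := domination_ge2_edge v cH gH2.
  have [i [x [iN xg xi]]] := mS g gE.
  have [d dD [s [ds sl ss]]] := Ddom (Ordinal (iN : i < N.+1)).
  exists (r d); first exact: imset_f.
  have dx : x \in hball (size s).*2.+1 (r d) by apply: path_ball ds (rP d) _; rewrite sl.
  by apply: hball_trans dx (hball_edge gE xg vg); lia.
have := leq_imset_card r D; move=> rD gr.
have {}gr := leq_trans gr rD.
case: Ds => Ds; first by have := leq_trans g2 (leq_trans gr Ds).
have l2' : l./2.-1.+1 = l./2 by lia.
rewrite l2' in Ds; apply: leq_trans NV; rewrite -mulnA mulnC leq_mul2r.
by rewrite (leq_trans _ Ds) ?orbT // leq_mul2r gr orbT.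
Qed.

End Packing.

(** * Constructions *)

Lemma exists_intermediate_set (T : finType) (A B : {set T}) k :
  A \subset B -> #|A| <= k -> k <= #|B| ->
  exists C : {set T}, [/\ A \subset C, C \subset B & #|C| = k].
Proof.
move=> AB Ak kB; elim: k kB Ak => [|k IHk] kB.
  by rewrite leqn0 => /eqP A0; exists A.
rewrite leq_eqVlt => /orP[/eqP Ak|Ak]; first by exists A.
have [C [AC CB Ck]] := IHk (ltnW kB) Ak.
have /properP[_ [x xB xC]] : C \proper B by rewrite properEcard CB Ck.
exists (x |: C); split; last by rewrite cardsU1 xC Ck.
  exact: subset_trans AC (subsetUr _ _).
by rewrite subUset sub1set xB.
Qed.

Section CliqueHypergraph.
Variables (V I : finType) (W : I -> {set V}) (k : nat).

Definition clique_hypergraph : hypergraph :=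
  Hypergraph [set e : {set V} | (#|e| == k) && [exists a, e \subset W a]].

Lemma clique_hypergraph_uniform : uniform clique_hypergraph k.
Proof. by move=> e; rewrite inE => /andP[/eqP]. Qed.

Lemma clique_joined : 2 <= k -> (forall a, k <= #|W a|) ->
  forall a (x y : V), x \in W a -> y \in W a ->
    berge_joined (x : vertex clique_hypergraph) y 1.
Proof.
move=> k2 kW a x y xa ya.
have [|||e [xye eW ek]] := @exists_intermediate_set V [set x; y] (W a) k.
- by rewrite subUset !sub1set xa.
- by rewrite (leq_trans _ k2) // cards2; case: (x != y).
- exact: kW.
move: xye; rewrite subUset !sub1set => /andP[xe ye].
apply: (@berge_joined_edge clique_hypergraph e x y) => //.
by rewrite inE ek eqxx; apply/existsP; exists a.
Qed.

Lemma clique_hball_lipschitz (phi : V -> nat) :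
    (forall a x y, x \in W a -> y \in W a -> phi y <= (phi x).+1) ->
  forall l (u v : vertex clique_hypergraph), v \in hball l u -> phi v <= phi u + l.
Proof.
move=> phiW; apply: hball_lipschitz => e x y; rewrite inE => /andP[_ /existsP[a /subsetP ea]].
by move=> /ea xa /ea; exact: phiW.
Qed.

End CliqueHypergraph.

Lemma card_tag (I : finType) (sz : I -> nat) (P : pred I) :
  #|[set x : {i : I & 'I_(sz i)} | P (tag x)]| = \sum_(i | P i) sz i.
Proof.
rewrite -sum1_card.
under eq_bigl do rewrite inE.
have := @sig_big_dep _ 0 addn I (fun i => 'I_(sz i)) P (fun _ => xpredT) (fun _ _ => 1).
under eq_bigr do rewrite sum1_card card_ord.
move=> ->; by apply: eq_bigl => x; rewrite andbT.
Qed.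

Lemma sum_alternating a b n : ~~ odd n ->
  \sum_(j < n) (if odd j then a else b) = n./2 * (a + b).
Proof.
move=> /even_halfK <-; rewrite doubleK; elim: n./2 => [|r IHr]; first by rewrite big_ord0.
by rewrite doubleS !big_ord_recr /= IHr odd_double /=; lia.
Qed.

(** * Branches attached to a core *)

Section Branches.
Variables (g l k : nat) (sz : nat -> nat -> nat).
Hypotheses (k_ge2 : 2 <= k) (sz_gt0 : forall i j, i < g -> j <= l -> 0 < sz i j).
Hypothesis sz_layers : forall i j, i < g -> j < l -> k <= sz i j + sz i j.+1.
Hypothesis sz_core : k <= \sum_(i < g) sz i 0.

Let V := {ij : 'I_g * 'I_l.+1 & 'I_(sz ij.1 ij.2)}.
Let branch (x : V) : 'I_g := (tag x).1.
Let layer (x : V) : nat := (tag x).2.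

Definition branch_clique (a : option ('I_g * 'I_l)) : {set V} :=
  if a is Some (i, j) then
    [set x | (branch x == i) && ((layer x == j) || (layer x == j.+1))]
  else [set x | layer x == 0].

Lemma branch_vertex (i : 'I_g) (j : nat) : j <= l ->
  exists x : V, branch x = i /\ layer x = j.
Proof.
move=> jl; have sz0 := sz_gt0 (ltn_ord i) jl.
by exists (@Tagged _ (i, Ordinal (jl : j < l.+1)) (fun ij => 'I_(sz ij.1 ij.2)) (Ordinal sz0)).
Qed.

Lemma branch_clique_card a : k <= #|branch_clique a|.
Proof.
case: a => [[i j]|] /=.
  rewrite (card_tag (fun ij : 'I_g * 'I_l.+1 => sz ij.1 ij.2)
    (fun ij => (ij.1 == i) && ((ij.2 == j :> nat) || (ij.2 == j.+1 :> nat)))).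
  have j0 : j < l.+1 by exact: ltnW (ltn_ord j).
  have j1 : j.+1 < l.+1 by exact: ltn_ord j.
  rewrite (bigD1 (i, Ordinal j0)) /= ?eqxx // (bigD1 (i, Ordinal j1)) /=; last first.
    by rewrite !eqxx orbT /= xpair_eqE eqxx /= -val_eqE /= (gtn_eqF (ltnSn j)).
  by rewrite addnA (leq_trans (sz_layers (ltn_ord i) (ltn_ord j))) // leq_addr.
rewrite (card_tag (fun ij : 'I_g * 'I_l.+1 => sz ij.1 ij.2) (fun ij => ij.2 == 0 :> nat)).
rewrite (leq_trans sz_core) //.
rewrite -(pair_big_dep xpredT (fun (_ : 'I_g) (j : 'I_l.+1) => j == 0 :> nat) (fun i j => sz i j)) /=.
by apply: leq_sum => i _; rewrite (bigD1 ord0) //= leq_addr.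
Qed.

(** A ball of radius [l] around a vertex of the last layer stays in its branch, so every branch
    contains a dominating vertex. *)
Lemma branches_dc_order : dc_order k g l (\sum_(i < g) \sum_(j < l.+1) sz i j).
Proof.
pose H := clique_hypergraph branch_clique k.
have join a (x y : V) := @clique_joined _ _ _ _ k_ge2 branch_clique_card a x y.
exists H; split.
- have core (x : V) : exists y m, layer y = 0 /\ berge_joined (x : vertex H) y m.
    move: {2}(layer x) (erefl (layer x)) => n; elim: n x => [|n IHn] x xn.
      by exists x, 0; split=> //; exact: berge_joined_refl.
    have nl : n < l by have := ltn_ord (tag x).2; rewrite -/(layer x) xn.
    have [y [yb yn]] := branch_vertex (branch x) (ltnW nl).
    have [z [m [z0 yz]]] := IHn y yn.
    exists z, (1 + m); split=> //; apply: berge_joined_trans yz.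
    by apply: (join (Some (branch x, Ordinal nl))); rewrite inE ?yb ?xn ?yn !eqxx ?orbT.
  move=> x y; have [x' [m [x'0 xx']]] := core x; have [y' [n [y'0 yy']]] := core y.
  exists (m + (1 + n)); apply: berge_joined_trans xx' _.
  apply: berge_joined_trans (berge_joined_sym yy').
  by apply: (join None); rewrite inE ?x'0 ?y'0.
- exact: clique_hypergraph_uniform.
- apply/dist_domination_numberP => D /dist_dominatingP Ddom.
  suff /subset_leq_card : [set: 'I_g] \subset [set branch x | x in (D : {set V})].
    by rewrite cardsT card_ord => /leq_trans; apply; exact: leq_imset_card.
  apply/subsetP => i _; have [w [wb wl]] := branch_vertex i (leqnn l).
  have [u uD /hball_sym wu] := Ddom w.
  apply/imsetP; exists u => //.
  (* A lower bound for the distance to [w]: the core has value l on branch [i] and l + 1 on the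
     others. *)
  pose phi (x : V) := if branch x == i then l - layer x else l.+1.
  have phi_lip a x y : x \in branch_clique a -> y \in branch_clique a ->
      phi y <= (phi x).+1.
    rewrite /phi; case: a => [[j m]|] /=; rewrite !inE.
      case/andP=> /eqP-> xl /andP[/eqP-> yl]; case: ifP => _ //; lia.
    by move=> /eqP-> /eqP->; do 2!case: ifP => _; lia.
  have := clique_hball_lipschitz phi_lip wu.
  rewrite /phi wb eqxx wl subnn add0n.
  by have [-> //|ui] := eqVneq (branch u) i; rewrite ltnn.
- have := card_tag (fun ij : 'I_g * 'I_l.+1 => sz ij.1 ij.2) xpredT.
  rewrite -(pair_bigA _ (fun (i : 'I_g) (j : 'I_l.+1) => sz i j)) /= => <-.
  by apply: eq_card => x; rewrite !inE.
Qed.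

End Branches.

Definition f_nat k g l :=
  if odd l then l.+1./2 * k * g else l./2 * k * g + maxn k g.

Lemma f_nat_dc_order k g l : 2 <= k -> 2 <= g -> dc_order k g l (f_nat k g l).
Proof.
move=> k2 g2; rewrite /f_nat; case: ifP => lo.
  (* Layers of sizes k - 1 and 1 alternate, so neighbours make k; the core has g(k - 1) >= k
     vertices. *)
  have := @branches_dc_order g l k (fun _ j => if odd j then 1 else k.-1) k2.
  have sumE : \sum_(j < l.+1) (if odd j then 1 else k.-1) = l.+1./2 * k.
    by rewrite sum_alternating ?add1n ?prednK /= ?lo //; lia.
  rewrite [X in dc_order _ _ _ X](_ : _ = l.+1./2 * k * g); last first.
    by rewrite sum_nat_const card_ord sumE mulnC.
  apply=> [i j _ _|i j _ _|].
  - by case: ifP; lia.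
  - by rewrite /=; case: (odd j) => /=; lia.
  - by rewrite /= sum_nat_const card_ord; nia.
(* The core needs k vertices and one in each branch, hence max(k, g): branch 0 takes the surplus.
   The other l layers pair up to k. *)
pose sz i j := if j is j'.+1 then (if odd j' then 1 else k.-1)
               else if i == 0 then maxn k g - g.-1 else 1.
have sum0 : \sum_(i < g) sz i 0 = maxn k g.
  case: g g2 @sz => // g' g2 sz; rewrite big_ord_recl /= sum_nat_const card_ord; lia.
have := @branches_dc_order g l k sz k2.
have -> : \sum_(i < g) \sum_(j < l.+1) sz i j = l./2 * k * g + maxn k g.
  under eq_bigr do rewrite big_ord_recl /= /bump /=.
  rewrite big_split /= sum0 sum_nat_const card_ord.
  have -> : \sum_(j < l) (if odd j then 1 else k.-1) = l./2 * (1 + k.-1).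
    by rewrite sum_alternating ?lo.
  by rewrite add1n prednK; lia.
apply=> [i [|j] _ _|i [|j] _ _|].
- by rewrite /sz; case: ifP; lia.
- by rewrite /sz; case: ifP; lia.
- by rewrite /sz /=; case: ifP; lia.
- by rewrite /sz /=; case: (odd j) => /=; lia.
- by rewrite sum0 leq_maxl.
Qed.

(** * The cycle of blocks with gaps *)

Section GapCycle.
Variables (l k : nat).
Hypotheses (l_gt0 : 0 < l) (k_ge3 : 3 <= k).

Let n := (2 * l).+1.
(** Neighbouring blocks total k + 1, or 2 floor(k/2) + 2 for the last and first; without one gap, at
    least k vertices remain. *)
Let sz (j : 'I_n) := if odd j then uphalf k else k./2.+1.
Let V := {j : 'I_n & 'I_(sz j)}.
Let gap (x : V) := (tagged x : nat) == 0.

(* The gap of the next block is left out of the clique, so that going around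
   the cycle in one direction always misses the gap of the last block. *)
Definition gap_clique (j : 'I_n) : {set V} :=
  [set x | (tag x == j) || ((tag x == ordS j) && ~~ gap x)].

Lemma sz_ge2 j : 1 < sz j.
Proof. by rewrite /sz; case: ifP; lia. Qed.

Lemma gap_cycle_vertex (j : 'I_n) (b : bool) : exists x : V, tag x = j /\ gap x = b.
Proof.
have bj : (~~ b : nat) < sz j by have := sz_ge2 j; case: b => /=; lia.
by exists (@Tagged _ j (fun j => 'I_(sz j)) (Ordinal bj)); split=> //; rewrite /gap /=; case: b bj.
Qed.

Lemma gap_inj x y : tag x = tag y -> gap x -> gap y -> x = y.
Proof.
case: x y => [i a] [j b]; rewrite /gap /= => ij; rewrite -{}ij in b *.
by move=> /eqP a0 /eqP b0; congr (existT _ i _); apply: val_inj; rewrite /= a0 b0.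
Qed.

Lemma val_ordS (j : 'I_n) : ordS j = (if j == 2 * l :> nat then 0 else j.+1) :> nat.
Proof.
rewrite /=; have := ltn_ord j; rewrite /n; case: eqVneq => [-> _|jl jn].
  by rewrite modnn.
by rewrite modn_small //; lia.
Qed.

Lemma gap_clique_card j : k <= #|gap_clique j|.
Proof.
have [g [gt gg]] := gap_cycle_vertex (ordS j) true.
have Sj : ordS j != j.
  apply/eqP => /(congr1 (@nat_of_ord n)); rewrite val_ordS.
  by case: eqVneq => [->|_]; lia.
have gapE x : tag x = ordS j -> gap x -> x = g.
  by move=> xt xg; apply: gap_inj; rewrite ?gt.
have cE : gap_clique j = [set x : V | (tag x == j) || (tag x == ordS j)] :\ g.
  apply/setP => x; rewrite !inE.
  have [->|xg] := eqVneq x g; first by rewrite gt (negbTE Sj) gg andbF.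
  case: eqP => //= _; case: eqP => //= xS.
  by apply/negP => /(gapE x xS); apply/eqP.
have := cardsD1 g [set x : V | (tag x == j) || (tag x == ordS j)].
rewrite -cE inE gt eqxx orbT (card_tag sz (fun i => (i == j) || (i == ordS j))).
rewrite (bigD1 j) ?eqxx //= (bigD1 (ordS j)) /= ?eqxx ?orbT //.
move: (\big[_/_]_(_ | _) _) #|gap_clique j| => s c; rewrite /sz val_ordS.
case: eqVneq => [jl|_]; last by rewrite /=; case: (odd j) => /=; lia.
by rewrite jl mul2n odd_double /=; lia.
Qed.

Let offset (a b : 'I_n) := (b + (n - a)) %% n.

Lemma offset_id a : offset a a = 0.
Proof. by rewrite /offset subnKC ?modnn // ltnW. Qed.

Lemma offset_ordS a b : offset a (ordS b) = if offset a b == 2 * l then 0 else (offset a b).+1.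
Proof.
have -> : offset a (ordS b) = (offset a b).+1 %% n.
  by rewrite /offset /= modnDml addSn -addn1 -modnDml addn1.
have : offset a b < (2 * l).+1 by exact: ltn_pmod.
move: (offset a b) => o on; case: eqVneq => [->|ol]; first exact: modnn.
by rewrite modn_small // /n; lia.
Qed.

(** A lower bound for the distance from block [a]: forwards [o] blocks, plus one for a gap, or
    backwards [n - o] blocks. *)
Let phi a (x : V) :=
  let o := offset a (tag x) in
  if o <= l then o + ((0 < o) && gap x) else n - o.

Lemma gap_cycle_lipschitz a j x y : x \in gap_clique j -> y \in gap_clique j ->
  phi a y <= (phi a x).+1.
Proof.
have on : offset a j < (2 * l).+1 by exact: ltn_pmod.
have oS := offset_ordS a j.
rewrite !inE /phi; case/orP=> [/eqP->|/andP[/eqP-> /negbTE->]];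
  case/orP=> [/eqP->|/andP[/eqP-> /negbTE->]]; rewrite ?oS /n ?andbF;
  move: (offset a j) on => o on; case: (eqVneq o (2 * l)) => ol;
  (try case: (gap x)); (try case: (gap y));
  rewrite ?andbT ?andbF ?addn0; case: (posnP o) => o0; rewrite /= ?addn0 ?addn1;
  repeat (case: ifP => ?); lia.
Qed.

Lemma gap_cycle_dc_order : dc_order k 2 l (l * k.+1 + k./2.+1).
Proof.
pose H := clique_hypergraph gap_clique k.
have join a (x y : V) := @clique_joined _ _ _ _ (ltnW k_ge3) gap_clique_card a x y.
exists H; split.
- have base (x : V) : exists y m, tag y = ord0 /\ berge_joined (x : vertex H) y m.
    move: {2}(tag x : nat) (erefl (tag x : nat)) => i; elim: i x => [|i IHi] x xi.
      exists x, 0; split; last exact: berge_joined_refl.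
      exact: val_inj.
    have iN : i < n by have := ltn_ord (tag x); rewrite xi; exact: ltnW.
    have [y [yt _]] := gap_cycle_vertex (Ordinal iN) true.
    (* The previous block's clique omits the gap, so the walk first moves to a non-gap vertex of its
       own block. *)
    have [z [zt zg]] := gap_cycle_vertex (tag x) false.
    have [y' [m [y'0 yy']]] := IHi y (congr1 val yt).
    exists y', (1 + (1 + m)); split=> //; apply: (@berge_joined_trans H x z).
      by apply: (join (tag x)); rewrite inE ?zt eqxx.
    apply: berge_joined_trans yy'; apply: (join (Ordinal iN)); rewrite inE ?yt ?eqxx //.
    rewrite zt zg andbT; apply/orP; right; apply/eqP/ord_inj; rewrite val_ordS xi /=.
    by have := ltn_ord (tag x); rewrite xi /n; case: eqVneq => //; lia.
  move=> x y; have [x' [m [x'0 xx']]] := base x; have [y' [m' [y'0 yy']]] := base y.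
  exists (m + (1 + m')); apply: berge_joined_trans xx' _.
  apply: berge_joined_trans (berge_joined_sym yy').
  by apply: (join ord0); rewrite inE ?x'0 ?y'0 eqxx.
- exact: clique_hypergraph_uniform.
- apply/dist_domination_numberP => D /dist_dominatingP Ddom.
  rewrite ltnNge; apply/negP => /card_le1_eqP D1.
  have [v0 _] := gap_cycle_vertex ord0 true.
  have [u uD _] := Ddom v0.
  pose a := tag (u : V).
  (* The gap [l] blocks ahead has potential l + 1, out of reach of a single dominating vertex in
     block [a]. *)
  have bn : (a + l) %% n < n by exact: ltn_pmod.
  have [t [tb tg]] := gap_cycle_vertex (Ordinal bn) true.
  have [u' u'D tu] := Ddom t; rewrite -(D1 _ _ u'D uD) in tu.
  have := clique_hball_lipschitz (gap_cycle_lipschitz a) tu.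
  rewrite /phi tb tg offset_id /=.
  have -> : offset a (Ordinal bn) = l.
    rewrite /offset /= modnDml addnAC subnKC ?(ltnW (ltn_ord a)) // modnDl modn_small //.
    by rewrite /n; lia.
  by rewrite leqnn l_gt0 /=; lia.
- have := card_tag sz xpredT; rewrite big_ord_recr /= sum_alternating ?mul2n ?odd_double //.
  rewrite /sz /= mul2n odd_double doubleK => cV.
  have kE : uphalf k + k./2.+1 = k.+1 by lia.
  by rewrite -kE -cV; apply: eq_card => x; rewrite !inE.
Qed.

End GapCycle.

(** * Bounds on the extremal function *)

(** One construction makes [n_dc] a genuine minimum, so that lower bounds for hypergraphs apply to
    it. *)
Lemma n_dc_spec k g l n : dc_order k g l n ->
  dc_order k g l (n_dc k g l) /\ n_dc k g l <= n.
Proof.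
move=> dcn; have ex : exists m, `[< dc_order k g l m >] by exists n; apply/asboolP.
case: (ex_minnP ex) => m /asboolP dcm mmin.
have -> : n_dc k g l = m.
  by apply: n_dcE; split=> // m' dcm'; apply: mmin; apply/asboolP.
by split=> //; apply: mmin; apply/asboolP.
Qed.

Lemma n_dc_le_f_nat k g l : 2 <= k -> 2 <= g -> n_dc k g l <= f_nat k g l.
Proof. by move=> k2 g2; case: (n_dc_spec (f_nat_dc_order l k2 g2)). Qed.

Lemma n_dc_ge k g l : 2 <= k -> 2 <= l -> 2 <= g -> k * g * l./2 <= n_dc k g l.
Proof.
move=> k2 l2 g2; have [[H [cH uH gH <-]] _] := n_dc_spec (f_nat_dc_order l k2 g2).
by apply: tree_packing_bound => //; exact: ltnW.
Qed.

Lemma n_dc2_ge k l : 2 <= k -> 2 <= l -> (2 * l + 1) * k <= 2 * n_dc k 2 l.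
Proof.
move=> k2 l2; have [[H [cH uH gH <-]] _] := n_dc_spec (f_nat_dc_order l k2 (leqnn 2)).
have [u _] := domination_ge1_vertex (ltnW gH).
by apply: radius_order_bound => // v; exact: domination_ge2_far.
Qed.

Lemma n_dc2_le_gap k l : 2 <= k -> 2 <= l ->
  2 * n_dc k 2 l <= (2 * l + 1) * k.+1 + 1.
Proof.
move=> k2 l2; have [k3|k3] := leqP 3 k.
  by have [_] := n_dc_spec (gap_cycle_dc_order (ltnW l2) k3); lia.
(* For k = 2 some blocks would consist of a gap only; the branch construction is small enough
   there. *)
have := n_dc_le_f_nat l k2 (leqnn 2); have -> : k = 2 by lia.
by rewrite /f_nat; case: ifP => lo; lia.
Qed.

Lemma f_nat2 k l : 2 <= k -> f_nat k 2 l = (l + 1) * k.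
Proof.
move=> k2; rewrite /f_nat (maxn_idPl k2); case: ifP => lo.
  have {2}-> : l = l.+1./2.*2.-1 by lia.
  by lia.
have {2}-> : l = l./2.*2 by lia.
by lia.
Qed.

Local Open Scope ring_scope.

Lemma f_natE k g l : (f_nat k g l)%:R = f_bound k g l.
Proof.
have two : (2 : rat) != 0 by [].
rewrite /f_nat /f_bound; case: ifP => lo.
  have lE : (l%:R + 1 : rat) = l.+1./2%:R * 2.
    by rewrite natr1 -natrM; congr _%:R; lia.
  by rewrite lE mulfK // !natrM.
have lE : (l%:R : rat) = l./2%:R * 2 by rewrite -natrM; congr _%:R; lia.
by rewrite lE mulfK // natrD !natrM.
Qed.

Theorem theorem2 :
  (forall k l : nat, (2 <= k)%N -> (2 <= l)%N ->
     ((2 * l%:R + 1) * k%:R / 2 : rat) <= (n_dc k 2 l)%:R /\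
     (n_dc k 2 l)%:Z <=
       Num.min (Num.ceil ((2 * l%:R + 1) * (k%:R + 1) / 2 : rat))
               ((l + 1) * k)%:Z) /\
  (forall k l gamma : nat, (2 <= k)%N -> (4 <= l)%N -> (3 <= gamma)%N ->
     k%:Z * Num.ceil (((l%:R - 1) / 2 - 1) * gamma%:R : rat)
       < (n_dc k gamma l)%:Z /\
     ((n_dc k gamma l)%:R : rat) <= f_bound k gamma l) /\
  (forall k gamma : nat, (2 <= k)%N -> (3 <= gamma)%N ->
     (k * gamma <= n_dc k gamma 2)%N /\
     (n_dc k gamma 2 <= k * gamma + maxn k gamma)%N) /\
  (forall k gamma : nat, (2 <= k)%N -> (3 <= gamma)%N ->
     (k * gamma <= n_dc k gamma 3)%N /\
     (n_dc k gamma 3 <= 2 * k * gamma)%N).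
Proof.
split=> [k l k2 l2|]; [|split=> [k l g k2 l4 g3|]; [|split=> k g k2 g3]].
- split.
    rewrite ler_pdivrMr //.
    by have := n_dc2_ge k2 l2; rewrite -(ler_nat rat) !natrM natrD natrM; lra.
  rewrite le_min; apply/andP; split; last first.
    by rewrite lez_nat -f_nat2 // n_dc_le_f_nat.
  (* An integer m is at most the ceiling of x exactly when m - 1 < x, which absorbs the rounding
     term of the gap cycle. *)
  rewrite -ltzD1 -ltrBlDr ceil_gt_int ltr_pdivlMr // intrB.
  have := n_dc2_le_gap k2 l2; rewrite -(ler_nat rat) natrD !natrM natrD natrM -natr1.
  by rewrite -pmulrn; lra.
- have l2 : (2 <= l)%N by lia.
  have g2 : (2 <= g)%N by lia.
  split; last by rewrite -f_natE ler_nat n_dc_le_f_nat.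
  (* Since l <= 2 floor(l/2) + 1, the argument is at most (floor(l/2) - 1) g; the slack g gives
     strictness. *)
  have cle : Num.ceil (((l%:R - 1) / 2 - 1) * g%:R : rat) <= (g * l./2)%:Z - 1.
    have lg : (l * g <= (2 * l./2 + 1) * g)%N by rewrite leq_mul2r; lia.
    have gR : 3 <= g%:R :> rat by rewrite ler_nat.
    rewrite ceil_le_int intrB -pmulrn natrM.
    by move: lg; rewrite -(ler_nat rat) !natrM natrD natrM; lra.
  have := n_dc_ge k2 l2 g2.
  nia.
- split.
    by have := n_dc_ge k2 (leqnn 2) (ltnW g3); rewrite muln1.
  by have := n_dc_le_f_nat 2 k2 (ltnW g3); rewrite /f_nat /= mul1n.
- split.
    by have := n_dc_ge k2 (isT : 2 <= 3)%N (ltnW g3); rewrite muln1.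
  by have := n_dc_le_f_nat 3 k2 (ltnW g3); rewrite /f_nat.
Qed.
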